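(* Let $\mathcal T$ be a Galton-Watson tree whose offspring distribution has finite mean $\lambda>1$, and consider the parking process on $\mathcal T$ with i.i.d. car arrivals distributed as $\eta(\alpha)$, where $(\eta(\alpha))$ is a stochastically increasing family of nonnegative integer-valued random variables with $E\eta(\alpha)=\alpha$. Let $X$ be the total number of cars that arrive to the root, and let $\alpha_c\in(0,1)$ be the critical threshold of the process. Then for all $\alpha\le\alpha_c$ it holds that $$E X=\frac{\lambda-\alpha-\lambda P(X=0)}{\lambda-1}.$$ (In particular, this holds at $\alpha=\alpha_c$.)
   Context: Parking process: on a tree $\mathcal T$ with root $\rho$, each vertex has one parking spot. Initially (time $0$) $\eta_v$ cars arrive to each vertex $v$. Cars move towards the root in discrete time, one edge per time step. When a car arrives at an available spot it parks there and the spot becomes unavailable; if several cars arrive at the same available spot simultaneously, one chosen uniformly at random parks there and the others continue towards the root. (This applies also to the cars arriving initially at a vertex.) $X\in\{0,1,2,\dots\}\cup\{\infty\}$ is the total number of cars that ever arrive to $\rho$, including the $\eta_\rho$ cars initially there. If $Z$ denotes the number of children of $\rho$, then $X=\eta_\rho+\sum_{i=1}^Z (X^{(i)}-1)^+$, where the $X^{(i)}$ are i.i.d. copies of $X$ (for the subtrees rooted at the children of $\rho$), independent of $Z$ and $\eta_\rho$, and $x^+=\max(0,x)$. Setting: $\mathcal T$ is a Galton-Watson tree with nonnegative integer-valued offspring variable $Z$, $EZ=\lambda\in(1,\infty)$. The $\eta_v$ are i.i.d. with law $\eta(\alpha)$, independent of $\mathcal T$. The family $(\eta(\alpha))$ is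 indexed by its mean $\alpha=E\eta(\alpha)$, with $\alpha$ ranging over an interval in $[0,\infty)$ containing $(0,1)$. It is stochastically increasing: $P(\eta(\alpha)\ge x)\le P(\eta(\alpha')\ge x)$ for all $x\ge0$ and $\alpha\le\alpha'$. Critical threshold: $\alpha_c\in(0,1)$ is the number such that $EX<\infty$ for $\alpha<\alpha_c$, while for $\alpha>\alpha_c$, conditionally on non-extinction of $\mathcal T$, $X=\infty$ almost surely (its existence is a theorem of Goldschmidt and Przykucki and is part of the standing assumptions). *)

(* Defs.v *)
(* Mathematical Components with MathComp-Analysis. *)
From HB Require Import structures.
From mathcomp Require Import all_boot all_order all_algebra.
From mathcomp Require Import all_classical all_reals all_analysis.
Import Order.TTheory GRing.Theory Num.Theory.
Import numFieldNormedType.Exports.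

Set Implicit Arguments.
Unset Strict Implicit.
Unset Printing Implicit Defensive.

Local Open Scope classical_set_scope.
Local Open Scope ring_scope.

(* Ulam-Harris words: the root is [::] and the i-th child of v is rcons v i. *)
Notation vertex := (seq nat).

(* The k-th car that arrives initially at v is (v, k). *)
Notation car := (vertex * nat)%type.

Definition plane_tree (Z : vertex -> nat) : set vertex :=
  [set v | forall n, (n < size v)%N -> (nth 0 v n < Z (take n v))%N].

(* Z v is the number of children of v, eta v the number of cars initially at v,
   and tie v m the position, in the list of cars arriving at v, of the one that
   parks if the spot at v is available when m cars arrive there together.  This
   happens at most once per vertex, so tie needs no time index.
   The recursion is run on all words; the words outside plane_tree Z have no
   effect on the tree, since v only receives cars from rcons v i with i < Z v. *)
Section parking_process.
Variables (Z eta : vertex -> nat) (tie : vertex -> nat -> nat).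

Definition go_on (available : bool) (k : nat) (s : seq car) : seq car :=
  if available then take k s ++ drop k.+1 s else s.

(* The cars arriving at each vertex at time t, and whether the spot of the
   vertex is available just before these arrivals. *)
Fixpoint parking (t : nat) : (vertex -> seq car) * (vertex -> bool) :=
  if t is t'.+1 then
    let: (arr, avail) := parking t' in
    (fun v => flatten [seq (let u := rcons v i in
                            go_on (avail u) (tie u (size (arr u))) (arr u))
                      | i <- iota 0 (Z v)],
     fun v => avail v && nilp (arr v))
  else (fun v => [seq (v, k) | k <- iota 0 (eta v)], fun=> true).

Definition arrivals (t : nat) (v : vertex) : seq car := (parking t).1 v.

(* Each car arrives at most once at the root. *)
Definition root_visits (R : realType) : \bar R :=
  (\sum_(0 <= t <oo) (size (arrivals t [::]))%:R%:E)%E.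

End parking_process.

Section probability.
Context d (T : measurableType d) (R : realType) (P : probability T R).

(* Every subset of nat is measurable. *)
Definition mutually_independent (I : choiceType) (X : I -> {RV P >-> nat}) :=
  forall (J : seq I) (A : I -> set nat), uniq J ->
    P (\bigcap_(i in [set` J]) (X i @^-1` A i)) =
    (\prod_(i <- J) P (X i @^-1` A i))%E.

Definition drivers (Z eta : vertex -> {RV P >-> nat})
    (tie : vertex -> nat -> {RV P >-> nat}) (i : vertex + vertex + vertex * nat)
    : {RV P >-> nat} :=
  match i with
  | inl (inl v) => Z v
  | inl (inr v) => eta v
  | inr (v, m) => tie v m
  end.

Record parking_model (offspring law : probability nat R)
    (Z eta : vertex -> {RV P >-> nat}) (tie : vertex -> nat -> {RV P >-> nat})
    : Prop := {
  offspring_law : forall v A, distribution P (Z v) A = offspring A ;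
  arrival_law : forall v A, distribution P (eta v) A = law A ;
  tie_range : forall v m w, (0 < m)%N -> (tie v m w < m)%N ;
  tie_uniform : forall v m j, (j < m)%N ->
    P (tie v m @^-1` [set j]) = (m%:R^-1)%:E ;
  model_independent : mutually_independent (drivers Z eta tie) }.

Definition root_arrivals (Z eta : vertex -> {RV P >-> nat})
    (tie : vertex -> nat -> {RV P >-> nat}) (w : T) : \bar R :=
  root_visits (fun v => Z v w) (fun v => eta v w) (fun v m => tie v m w) R.

(* As P-almost every statement restricted to the event that the tree is
   infinite; this event has positive probability when the offspring mean is
   greater than 1. *)
Definition critical_threshold (I : set R) (Z : vertex -> {RV P >-> nat})
    (eta : R -> vertex -> {RV P >-> nat})
    (tie : vertex -> nat -> {RV P >-> nat}) (ac : R) : Prop :=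
  [/\ 0 < ac < 1,
      forall a, I a -> a < ac ->
        (\int[P]_w root_arrivals Z (eta a) tie w < +oo)%E
    & forall a, I a -> ac < a ->
        {ae P, forall w, infinite_set (plane_tree (fun v => Z v w)) ->
                         root_arrivals Z (eta a) tie w = +oo%E} ].

End probability.

Record arrival_family (R : realType) (I : set R) (law : R -> probability nat R)
    : Prop := {
  index_interval : is_interval I ;
  index_ge0 : I `<=` [set a | 0 <= a] ;
  index_unit : `]0, 1[%classic `<=` I ;
  arrival_mean : forall a, I a -> ('E_(law a)[ (fun k : nat => k%:R) ] = a%:E)%E ;
  stochastically_increasing : forall a b, I a -> I b -> a <= b ->
    forall x : nat, (law a [set k | (x <= k)%N] <= law b [set k | (x <= k)%N])%E }.

(* Main.v *)
(* If N_t v cars arrive at v before time t, then N_{t+1} v is eta v plus the sum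
   of (N_t u - 1)^+ over the children u of v, because every car but the one that
   parks is sent on.  With m_t the mean of N_t at the root and p_t the probability
   that it vanishes, this gives m_{t+1} = a + lambda (m_t - 1 + p_t); when the
   limit E X of m_t is finite, letting t go to infinity gives the formula.

   It remains to see that E X is finite at criticality.  The law of N_t is
   stochastically increasing in a, so p_t is decreasing in a and the recursion
   gives m_t(b) <= m_t(a) + (b - a) (1 + ... + lambda^(t-1)) for a <= b.  For
   a < alpha_c the formula yields m_t(a) <= lambda / (lambda - 1); letting a
   increase to alpha_c for fixed t extends this bound to alpha_c. *)
Require Import Defs.
From HB Require Import structures.
From mathcomp Require Import all_boot all_order all_algebra.
From mathcomp Require Import all_classical all_reals all_analysis.
From mathcomp Require Import measurable_realfun zify ring lra.
Import Order.TTheory GRing.Theory Num.Theory.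
Import numFieldNormedType.Exports.

Set Implicit Arguments.
Unset Strict Implicit.
Unset Printing Implicit Defensive.

Local Open Scope classical_set_scope.
Local Open Scope ring_scope.

(** * Deterministic counts: eliminating time and tie-breaking from the process *)

Fixpoint cars_before (Z eta : vertex -> nat) (t : nat) (v : vertex) : nat :=
  if t is t'.+1 then
    (eta v + \sum_(i < Z v) (cars_before Z eta t' (rcons v i)).-1)%N
  else 0%N.

(** Removing position [k] loses a car only when [k] is in range: past the end, [take k s] is all of
    [s] and nobody parks. This is the reason for the hypothesis, which is void for an empty list. *)
Lemma size_go_on (b : bool) (k : nat) (s : seq car) :
  (s != [::] -> (k < size s)%N) ->
  size (go_on b k s) = (size s - (b && ~~ nilp s))%N.
Proof.
rewrite /go_on; case: b => [|_]; last by rewrite subn0.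
case: s => [//|x s] /(_ isT) ks.
by rewrite size_cat size_take ks size_drop; move: ks => /=; lia.
Qed.

Section parking_counts.
Variables (Z eta : vertex -> nat) (tie : vertex -> nat -> nat).
Hypothesis tie_lt : forall v m, (0 < m)%N -> (tie v m < m)%N.

Let sent t u :=
  go_on ((parking Z eta tie t).2 u) (tie u (size (arrivals Z eta tie t u)))
        (arrivals Z eta tie t u).

Lemma arrivalsS t v : arrivals Z eta tie t.+1 v =
  flatten [seq sent t (rcons v i) | i <- iota 0 (Z v)].
Proof. by rewrite /arrivals /sent /arrivals /=; case: (parking Z eta tie t). Qed.

(** The first nonempty batch of arrivals takes the spot, so availability is a function of the
    cumulative count alone. *)
Lemma spot_available t v : (parking Z eta tie t).2 v =
  (\sum_(s < t) size (arrivals Z eta tie s v) == 0)%N.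
Proof.
elim: t => [|t IH]; first by rewrite big_ord0.
have -> : (parking Z eta tie t.+1).2 v =
    (parking Z eta tie t).2 v && nilp (arrivals Z eta tie t v).
  by rewrite /arrivals /=; case: (parking Z eta tie t).
by rewrite IH big_ord_recr /= addn_eq0 /nilp.
Qed.

(* Every car but the one that parks is eventually sent on. *)
Lemma sum_sent t u : (\sum_(s < t) size (sent s u) =
  (\sum_(s < t) size (arrivals Z eta tie s u)).-1)%N.
Proof.
elim: t => [|t IH]; first by rewrite !big_ord0.
rewrite !big_ord_recr /= IH size_go_on.
  by rewrite spot_available /nilp; case: eqP; case: eqP => /=; lia.
by move=> s0; apply: tie_lt; rewrite lt0n size_eq0.
Qed.

Lemma sum_arrivals t v :
  (\sum_(s < t) size (arrivals Z eta tie s v))%N = cars_before Z eta t v.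
Proof.
elim: t v => [|t IH] v; first by rewrite big_ord0.
(* Time 0 contributes the [eta v] initial cars. Later arrivals were sent on by the children one step
   earlier, so exchanging the sums over times and children leaves one use of [sum_sent] per
   child. *)
rewrite big_ord_recl /= /arrivals /= size_map size_iota; congr addn.
under eq_bigr => s _ do
  rewrite -/(arrivals Z eta tie s.+1 v) arrivalsS size_flatten sumnE big_map big_map.
rewrite exchange_big /=.
rewrite -(big_mkord xpredT (fun i => (cars_before Z eta t (rcons v i)).-1)).
by rewrite /index_iota subn0; apply: eq_bigr => i _; rewrite sum_sent IH.
Qed.

Lemma root_visitsE (R : realType) : root_visits Z eta tie R =
  limn (fun t => (cars_before Z eta t [::])%:R%:E).
Proof.
rewrite /root_visits; congr (limn _); apply/funext => t.
by rewrite -sum_arrivals sumEFin big_mkord natr_sum.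
Qed.

End parking_counts.

Lemma leq_cars_before (Z eta : vertex -> nat) t v :
  (cars_before Z eta t v <= cars_before Z eta t.+1 v)%N.
Proof.
elim: t v => // t IH v /=.
by rewrite leq_add2l; apply: leq_sum => i _; have := IH (rcons v i) => /=; lia.
Qed.

(** Splitting on the value of the random index [f] reduces sums with a random number of terms to
    sums of fixed length. *)
Lemma preimage_mix (T : Type) (f : T -> nat) (g : nat -> T -> nat) A :
  (fun w => g (f w) w) @^-1` A = \bigcup_n (f @^-1` [set n] `&` g n @^-1` A).
Proof. by apply/seteqP; split=> [w ?|w [n _ [/= -> //]]]; exists (f w). Qed.

(** * Independence of variables built from disjoint families of drivers *)

Section independence.
Context d (T : measurableType d) (R : realType) (P : probability T R).
Context (I : choiceType) (X : I -> {RV P >-> nat}).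

(** The pi-system on which [mutually_independent] directly gives a product formula; it generates the
    sigma-algebra of the [X i] with [i] in [G]. *)
Definition cylinders (G : set I) : set (set T) :=
  [set E | exists (J : seq I) (A : I -> set nat), [/\ uniq J, [set` J] `<=` G
    & E = \bigcap_(i in [set` J]) (X i @^-1` A i)]].

Definition depends_on (G : set I) (f : T -> nat) :=
  forall A, <<s cylinders G >> (f @^-1` A).

Lemma cylindersT G : cylinders G setT.
Proof.
exists [::], (fun=> setT); split => //; rewrite set_nil ?bigcap_set0 //.
Qed.

Lemma measurable_preimage_nat (f : {RV P >-> nat}) (A : set nat) :
  measurable (f @^-1` A).
Proof. by rewrite -[_ @^-1` _]setTI; exact: measurable_funP. Qed.

Lemma cylinders_measurable G : cylinders G `<=` measurable.
Proof.
move=> _ [J [A [_ _ ->]]]; apply: fin_bigcap_measurable => [|i _].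
  exact: finite_seq.
exact: measurable_preimage_nat.
Qed.

Lemma sigma_cylinders_measurable G : <<s cylinders G >> `<=` measurable.
Proof.
apply: smallest_sub; first exact: sigma_algebra_measurable.
exact: cylinders_measurable.
Qed.

Lemma cylinders_setI G : setI_closed (cylinders G).
Proof.
move=> _ _ [J1 [A1 [_ JG1 ->]]] [J2 [A2 [_ JG2 ->]]].
(* [B] pads a family with [setT] off its own list, so that both families live on the union of the
   two lists, which may overlap. *)
pose B (J : seq I) (A : I -> set nat) i := if i \in J then A i else setT.
exists (undup (J1 ++ J2)), (fun i => B J1 A1 i `&` B J2 A2 i); split.
- exact: undup_uniq.
- move=> i /=; rewrite mem_undup mem_cat => /orP[iJ|iJ].
    exact: JG1.
  exact: JG2.
- apply/seteqP; split => w /=.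
    by move=> [h1 h2] i _; split; rewrite /B; case: ifPn => // iJ;
      [exact: h1|exact: h2].
  move=> h; split=> i iJ.
    have /h[] : i \in undup (J1 ++ J2) by rewrite mem_undup mem_cat iJ.
    by rewrite /B iJ.
  have /h[] : i \in undup (J1 ++ J2) by rewrite mem_undup mem_cat iJ orbT.
  by rewrite /B iJ.
Qed.

Hypothesis X_indep : mutually_independent X.

Lemma cylinders_independent (G H : set I) (E F : set T) : G `&` H = set0 ->
  cylinders G E -> cylinders H F -> P (E `&` F) = (P E * P F)%E.
Proof.
move=> GH [J1 [A1 [u1 JG1 ->]]] [J2 [A2 [u2 JG2 ->]]].
have disj i : i \in J2 -> i \notin J1.
  by move=> i2; apply/negP => i1; have : set0 i by rewrite -GH; split; auto.
pose A i := if i \in J1 then A1 i else A2 i.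
have -> : \bigcap_(i in [set` J1]) (X i @^-1` A1 i)
    `&` \bigcap_(i in [set` J2]) (X i @^-1` A2 i) =
    \bigcap_(i in [set` J1 ++ J2]) (X i @^-1` A i).
  apply/seteqP; split => w /=.
    move=> [h1 h2] i /=; rewrite mem_cat /A; case: ifP => [iJ _|_ /= iJ].
      exact: h1.
    exact: h2.
  move=> h; split=> i iJ.
    have := h i; rewrite /= mem_cat iJ /A => /(_ isT).
    by have -> : (i \in J1) = true by exact: iJ.
  have := h i; rewrite /= mem_cat iJ orbT /A => /(_ isT).
  by rewrite (negbTE (disj _ iJ)).
rewrite !X_indep //; last first.
  by rewrite cat_uniq u1 u2 andbT; apply/hasPn => i /disj.
rewrite big_cat /=; congr (_ * _)%E; apply: eq_big_seq => i iJ; rewrite /A.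
  by rewrite iJ.
by rewrite (negbTE (disj _ iJ)).
Qed.

(** For fixed [F], both sides are finite measures in [E]: the restriction of [P] to [F], and [P]
    scaled by [P F]. Agreement on a pi-system extends to the sigma-algebra it generates. *)
Lemma extend_independence (G : set I) (F : set T) : measurable F ->
  (forall E, cylinders G E -> P (E `&` F) = (P E * P F)%E) ->
  forall E, <<s cylinders G >> E -> P (E `&` F) = (P E * P F)%E.
Proof.
move=> mF GF E GE.
have PF0 : 0 <= fine (P F) by exact: fine_ge0.
have PFE A : (P A * P F)%E = mscale (NngNum PF0) P A.
  by rewrite /mscale /= fineK ?fin_num_measure// muleC.
rewrite PFE.
apply: (g_sigma_algebra_measure_unique (cylinders G) (@cylinders_measurable G)
  (fun=> setT) _ _ (mrestr P mF)) => //.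
- by move=> _; exact: cylindersT.
- by apply/seteqP; split => // w _; exists 0%N.
- exact: cylinders_setI.
- by move=> A GA; apply: eq_trans (PFE A); exact: GF.
- move=> _; change (P (setT `&` F) < +oo)%E.
  by rewrite setTI ltey_eq fin_num_measure.
Qed.

(** The extension is applied twice, once in each argument, starting from the product formula for
    cylinders. *)
Lemma sigma_independent (G H : set I) (E F : set T) : G `&` H = set0 ->
  <<s cylinders G >> E -> <<s cylinders H >> F -> P (E `&` F) = (P E * P F)%E.
Proof.
move=> GH GE HF; apply: (extend_independence _ _ GE).
  exact: (sigma_cylinders_measurable HF).
move=> {GE}E GE; rewrite setIC muleC.
apply: (extend_independence _ _ HF); first exact: (cylinders_measurable GE).
by move=> {HF}F HF; rewrite setIC muleC; exact: (cylinders_independent GH).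
Qed.

Lemma depends_on_driver G i : G i -> depends_on G (X i).
Proof.
move=> Gi A; apply: sub_sigma_algebra.
exists [:: i], (fun=> A); split => //; first by move=> j /=; rewrite inE => /eqP ->.
apply/seteqP; split=> w /= h; first by move=> j /=; rewrite inE => /eqP ->.
by apply: h; rewrite /= inE.
Qed.

Lemma depends_on_subset G H f : G `<=` H -> depends_on G f -> depends_on H f.
Proof.
move=> GH fG A; apply: sub_smallest2r (fG A) => //.
by move=> _ [J [B [uJ JG ->]]]; exists J, B; split => //; exact: subset_trans GH.
Qed.

Lemma depends_on_mix G (f : T -> nat) (g : nat -> T -> nat) : depends_on G f ->
  (forall n, depends_on G (g n)) -> depends_on G (fun w => g (f w) w).
Proof.
move=> fG gG A.
rewrite preimage_mix.
apply: (@bigcupT_measurable _ (g_sigma_algebraType (cylinders G))) => n.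
by apply: (@measurableI _ (g_sigma_algebraType (cylinders G)));
  [exact: fG|exact: gG].
Qed.

Lemma depends_on_comp G (h : nat -> nat) f :
  depends_on G f -> depends_on G (h \o f).
Proof. by move=> fG A; exact: (fG (h @^-1` A)). Qed.

Lemma depends_on_add G f g : depends_on G f -> depends_on G g ->
  depends_on G (fun w => f w + g w)%N.
Proof.
move=> fG gG; apply: (depends_on_mix (g := fun n w => (n + g w)%N) fG) => n.
exact: (depends_on_comp (addn n)).
Qed.

Lemma depends_on_cst G n : depends_on G (fun=> n).
Proof.
move=> A; rewrite preimage_cst; case: ifP => _;
  [exact: (@measurableT _ (g_sigma_algebraType (cylinders G)))
  |exact: (@measurable0 _ (g_sigma_algebraType (cylinders G)))].
Qed.

Lemma depends_on_sum G n (f : nat -> T -> nat) :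
  (forall i, (i < n)%N -> depends_on G (f i)) ->
  depends_on G (fun w => \sum_(i < n) f i w)%N.
Proof.
elim: n => [|n IH] fG.
  by under eq_fun do rewrite big_ord0; exact: depends_on_cst.
under eq_fun do rewrite big_ord_recr /=; apply: depends_on_add; last exact: fG.
by apply: IH => i iltn; apply: fG; exact: ltnW.
Qed.

Lemma depends_on_measurable G f A : depends_on G f -> measurable (f @^-1` A).
Proof. by move=> fG; exact: sigma_cylinders_measurable (fG A). Qed.

Lemma depends_on_independent G H f g A B : G `&` H = set0 ->
  depends_on G f -> depends_on H g ->
  P (f @^-1` A `&` g @^-1` B) = (P (f @^-1` A) * P (g @^-1` B))%E.
Proof. by move=> GH fG gH; apply: (sigma_independent GH); [exact: fG|exact: gH]. Qed.

End independence.

(** * Expectations of natural-valued variables through their tails *)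

Definition nat_measurable d (T : measurableType d) (f : T -> nat) :=
  forall A : set nat, measurable (f @^-1` A).

Section expectation.
Local Open Scope ereal_scope.
Context d (T : measurableType d) (R : realType).

Lemma nat_measurable_fun (f : T -> nat) (h : nat -> \bar R) :
  nat_measurable f -> measurable_fun setT (h \o f : T -> \bar R).
Proof. by move=> mf _ B mB; rewrite setTI; exact: (mf (h @^-1` B)). Qed.

Lemma nat_measurable_mix (f : T -> nat) (g : nat -> T -> nat) :
  nat_measurable f -> (forall n, nat_measurable (g n)) ->
  nat_measurable (fun w => g (f w) w).
Proof.
move=> mf mg A.
rewrite preimage_mix; apply: bigcupT_measurable => n.
by apply: measurableI; [exact: mf|exact: mg].
Qed.

Lemma nneseries_if_lt (F : nat -> \bar R) n : (forall i, 0 <= F i) ->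
  \sum_(i <oo) (if (i < n)%N then F i else 0) = \sum_(i < n) F i.
Proof.
move=> F0; rewrite (nneseries_split 0 n) => [|k _]; last by case: ifP.
rewrite add0n eseries0 => [|i ni _]; last by rewrite ltnNge ni.
by rewrite adde0 big_mkord; apply: eq_bigr => i _; rewrite ltn_ord.
Qed.

(** A natural number [n] is the sum over [k] of the indicators of [k < n]; these are integrated term
    by term. *)
Lemma mean_tails (mu : {measure set T -> \bar R}) (f : T -> nat) :
  nat_measurable f ->
  \int[mu]_w (f w)%:R%:E = \sum_(k <oo) mu [set w | (k < f w)%N].
Proof.
move=> mf.
have fE w : (f w)%:R%:E = \sum_(k <oo) (\1_[set w | (k < f w)%N] w)%:E :> \bar R.
  transitivity (\sum_(k <oo) (if (k < f w)%N then 1 else 0) : \bar R).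
    by rewrite nneseries_if_lt // sumEFin sumr_const card_ord.
  apply: eq_eseriesr => k _; rewrite indicE.
  case: ifP => h; first by rewrite mem_set.
  by rewrite memNset //= h.
under eq_integral do rewrite fE.
rewrite integral_nneseries //.
  apply: eq_eseriesr => k _; rewrite integral_indic ?setIT //.
  exact: (mf [set n | (k < n)%N]).
move=> k; apply/measurable_EFinP; apply: measurable_indic.
exact: (mf [set n | (k < n)%N]).
Qed.

Lemma mean_add (mu : {measure set T -> \bar R}) (f g : T -> nat) :
  nat_measurable f -> nat_measurable g ->
  \int[mu]_w (f w + g w)%N%:R%:E =
  \int[mu]_w (f w)%:R%:E + \int[mu]_w (g w)%:R%:E.
Proof.
move=> mf mg; under eq_integral do rewrite natrD EFinD.
by rewrite ge0_integralD //; [exact: (nat_measurable_fun (fun n => n%:R%:E) mf)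
  |exact: (nat_measurable_fun (fun n => n%:R%:E) mg)].
Qed.

(** A form of Wald's identity. The sum runs over all [i] once its terms are set to 0 for [i >= Z];
    by independence the term [i] has mean [mu (i < Z)] times [y], and these weights add up to the
    mean of [Z]. *)
Lemma mean_random_sum (mu : {measure set T -> \bar R}) (Z : T -> nat)
    (Y : nat -> T -> nat) (y : R) :
  nat_measurable Z -> (forall i, nat_measurable (Y i)) ->
  (forall i k, mu ([set w | (i < Z w)%N] `&` [set w | (k < Y i w)%N]) =
    mu [set w | (i < Z w)%N] * mu [set w | (k < Y i w)%N]) ->
  (forall i, mu [set w | (i < Z w)%N] \is a fin_num) ->
  (forall i, \int[mu]_w (Y i w)%:R%:E = y%:E) ->
  \int[mu]_w (\sum_(i < Z w) Y i w)%N%:R%:E = y%:E * \int[mu]_w (Z w)%:R%:E.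
Proof.
move=> mZ mY ind fZ EY.
pose h i w := if (i < Z w)%N then Y i w else 0%N.
have mh i : nat_measurable (h i).
  apply: (nat_measurable_mix (g := fun n w => if (i < n)%N then Y i w else 0%N))
    => // n A.
  case: (i < n)%N; first exact: mY.
  by rewrite preimage_cst; case: ifP => _.
have hE w : (\sum_(i < Z w) Y i w)%N%:R%:E = \sum_(i <oo) (h i w)%:R%:E :> \bar R.
  rewrite natr_sum -sumEFin -(nneseries_if_lt (F := fun i => (Y i w)%:R%:E)).
    by apply: eq_eseriesr => i _; rewrite /h; case: ifP.
  by move=> i; rewrite lee_fin.
under eq_integral do rewrite hE.
rewrite integral_nneseries //; last first.
  by move=> i; exact: (nat_measurable_fun (fun n => n%:R%:E) (mh i)).
rewrite mean_tails // -nneseriesZl //.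
apply: eq_eseriesr => i _; rewrite mean_tails //.
rewrite -(EY i) mean_tails // muleC -(fineK (fZ i)) -nneseriesZl //.
apply: eq_eseriesr => k _; rewrite (fineK (fZ i)) -ind; congr (mu _).
by apply/seteqP; split=> w; rewrite /h /=; case: ifP => // iZ; case.
Qed.

End expectation.

(** * Stochastic order, and its stability under mixtures and independent sums *)

Section stochastic_order.
Local Open Scope ereal_scope.
Context d (T : measurableType d) (R : realType) (P : probability T R).

Definition stochastic_le (f g : T -> nat) :=
  forall k, P [set w | (k < f w)%N] <= P [set w | (k < g w)%N].

Definition independent_nat (f g : T -> nat) := forall A B : set nat,
  P (f @^-1` A `&` g @^-1` B) = P (f @^-1` A) * P (g @^-1` B).

Lemma tail_mix (f : T -> nat) (g : nat -> T -> nat) k :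
  nat_measurable f -> (forall n, nat_measurable (g n)) ->
  (forall n, independent_nat f (g n)) ->
  P [set w | (k < g (f w) w)%N] =
  \sum_(n <oo) P (f @^-1` [set n]) * P [set w | (k < g n w)%N].
Proof.
move=> mf mg fg.
have -> : [set w | (k < g (f w) w)%N] =
    \bigcup_n (f @^-1` [set n] `&` [set w | (k < g n w)%N]).
  exact: (preimage_mix f g [set m | (k < m)%N]).
have mfg n : measurable (f @^-1` [set n] `&` [set w | (k < g n w)%N]).
  by apply: measurableI; [exact: mf|exact: (mg n [set m | (k < m)%N])].
rewrite measure_semi_bigcup //; last exact: bigcupT_measurable.
  by apply: eq_eseriesr => n _; exact: (fg n [set n] [set m | (k < m)%N]).
by move=> n m _ _ [w [[/= <- _] [/= <- _]]].
Qed.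

(** Conditioning on the index writes both tails as mixtures with the same weights, since [f] and
    [f'] have the same law. *)
Lemma mix_stochastic_le (f f' : T -> nat) (g g' : nat -> T -> nat) :
  nat_measurable f -> nat_measurable f' ->
  (forall n, nat_measurable (g n)) -> (forall n, nat_measurable (g' n)) ->
  (forall n, independent_nat f (g n)) -> (forall n, independent_nat f' (g' n)) ->
  (forall n, P (f @^-1` [set n]) = P (f' @^-1` [set n])) ->
  (forall n, stochastic_le (g n) (g' n)) ->
  stochastic_le (fun w => g (f w) w) (fun w => g' (f' w) w).
Proof.
move=> mf mf' mg mg' fg fg' ff' gg' k; rewrite !tail_mix //.
apply: lee_nneseries => n _; first by rewrite mule_ge0.
by rewrite ff' lee_pmul //; exact: gg'.
Qed.

(** The case [k < n] is separate because [k - n] truncates to 0 there, which would leave the event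
    [0 < f w] instead of a certain one. *)
Lemma tail_addn n (f : T -> nat) k : P [set w | (k < n + f w)%N] =
  if (k < n)%N then 1 else P [set w | (k - n < f w)%N].
Proof.
case: ltnP => kn.
  rewrite -(@probability_setT _ _ _ P); congr (P _).
  by apply/seteqP; split=> w //= _; exact: ltn_addr.
by congr (P _); apply/seteqP; split=> w /=; lia.
Qed.

Lemma stochastic_le_addn n (f g : T -> nat) :
  stochastic_le f g -> stochastic_le (fun w => n + f w)%N (fun w => n + g w)%N.
Proof. by move=> fg k; rewrite !tail_addn; case: ifP. Qed.

Lemma nat_measurable_addn n (f : T -> nat) :
  nat_measurable f -> nat_measurable (fun w => n + f w)%N.
Proof. by move=> mf A; exact: (mf (addn n @^-1` A)). Qed.

Lemma independent_nat_comp (h : nat -> nat) f g :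
  independent_nat f g -> independent_nat f (h \o g).
Proof. by move=> fg A B; exact: (fg A (h @^-1` B)). Qed.

(* Both sides are the tail at [k] of the sum of two independent variables with
   the laws of [f] and [g]. *)
Lemma tail_add_swap (f g : T -> nat) k :
  nat_measurable f -> nat_measurable g ->
  \sum_(n <oo) P (f @^-1` [set n]) * P [set w | (k < n + g w)%N] =
  \sum_(n <oo) P (g @^-1` [set n]) * P [set w | (k < n + f w)%N].
Proof.
have expand (u v : T -> nat) : nat_measurable u -> nat_measurable v ->
    \sum_(n <oo) P (u @^-1` [set n]) * P [set w | (k < n + v w)%N] =
    \sum_(n <oo) \sum_(m <oo) P (u @^-1` [set n]) * P (v @^-1` [set m]) *
      (k < n + m)%N%:R%:E.
  move=> mu mv; apply: eq_eseriesr => n _.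
  have Pun : P (u @^-1` [set n]) = (fine (P (u @^-1` [set n])))%:E.
    by rewrite fineK // fin_num_measure //; exact: mu.
  have cstE m A : P ((fun=> (n + m)%N) @^-1` A) = ((n + m)%N \in A)%:R%:E.
    by rewrite preimage_cst; case: ifP; rewrite ?probability_setT ?measure0.
  rewrite (tail_mix k (g := fun m _ => (n + m)%N)) //.
  - rewrite Pun -nneseriesZl => [|m _]; last by rewrite mule_ge0.
    apply: eq_eseriesr => m _; rewrite -muleA; congr (_ * (_ * _)).
    rewrite [LHS](cstE m [set j | (k < j)%N]).
    by case: (boolP (_ \in _)); rewrite ?in_setE ?notin_setE /=; case: ltnP.
  - by move=> m A; rewrite preimage_cst; case: ifP => _.
  - move=> m A B; rewrite cstE preimage_cst; case: ifP => _.
      by rewrite setIT mule1.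
    by rewrite setI0 measure0 mule0.
move=> mf mg; rewrite !expand // nneseries_interchange.
  by apply: eq_eseriesr => n _; apply: eq_eseriesr => m _;
    rewrite addnC [_ * P (g @^-1` _)]muleC.
by move=> n m; rewrite !mule_ge0.
Qed.

(** One summand is replaced at a time: conditioning on the first summand replaces [g] by [g'], and
    after [tail_add_swap] conditioning on the second replaces [f] by [f']. The intermediate term is
    the convolution of the laws of [f] and [g'], which need not be independent. *)
Lemma stochastic_le_add (f f' g g' : T -> nat) :
  nat_measurable f -> nat_measurable f' ->
  nat_measurable g -> nat_measurable g' ->
  independent_nat f g -> independent_nat f' g' ->
  stochastic_le f f' -> stochastic_le g g' ->
  stochastic_le (fun w => f w + g w)%N (fun w => f' w + g' w)%N.
Proof.
move=> mf mf' mg mg' fg fg' ff' gg' k.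
have tail_add (u v : T -> nat) : nat_measurable u -> nat_measurable v ->
    independent_nat u v -> P [set w | (k < u w + v w)%N] =
    \sum_(n <oo) P (u @^-1` [set n]) * P [set w | (k < n + v w)%N].
  move=> mu mv uv; apply: (tail_mix k (g := fun n w => (n + v w)%N)) => // n.
    exact: nat_measurable_addn.
  exact: (independent_nat_comp (addn n)).
have mono (u v v' : T -> nat) : stochastic_le v v' ->
    \sum_(n <oo) P (u @^-1` [set n]) * P [set w | (k < n + v w)%N] <=
    \sum_(n <oo) P (u @^-1` [set n]) * P [set w | (k < n + v' w)%N].
  move=> vv'; apply: lee_nneseries => n _; first by rewrite mule_ge0.
  by rewrite lee_wpmul2l //; exact: stochastic_le_addn.
rewrite !tail_add // (le_trans (mono _ _ _ gg')) //.
by rewrite tail_add_swap // [leRHS]tail_add_swap // mono.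
Qed.

End stochastic_order.

(** * Subtrees and the drivers attached to them *)

Lemma prefix_rconsE (v u : vertex) i : prefix (rcons v i) u =
  [&& prefix v u, (size v < size u)%N & nth 0%N u (size v) == i].
Proof.
apply/idP/idP.
  case/prefixP => s ->; rewrite -cats1 -catA prefix_prefix size_cat /=.
  by rewrite nth_cat ltnn subnn eqxx andbT; lia.
case/and3P => /prefixP[[|j s] ->].
  (* Here [u = v]: the length test excludes the default value 0 of [nth], which would pass for the
     child 0. *)
  by rewrite cats0 ltnn.
rewrite nth_cat ltnn subnn /= => _ /eqP ->.
by rewrite -cat_rcons prefix_prefix.
Qed.

(** The offspring and arrival drivers of the subtree at [v]. Tie-breaking drivers are left out
    because [cars_before] does not involve them. *)
Definition below (v : vertex) : set (vertex + vertex + vertex * nat) :=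
  [set i | match i with
           | inl (inl u) | inl (inr u) => is_true (prefix v u)
           | inr _ => False
           end].

Definition below_children (v : vertex) (n : nat) :
    set (vertex + vertex + vertex * nat) :=
  [set i | exists2 j, (j < n)%N & below (rcons v j) i].

Lemma below_rcons v i : below (rcons v i) `<=` below v.
Proof. by case=> [[u|u]|//] /=; rewrite prefix_rconsE => /andP[]. Qed.

(** A common descendant would have both [i] and [j] as its letter at position [size v]. *)
Lemma below_rcons_disjoint v i j : i != j ->
  below (rcons v i) `&` below (rcons v j) = set0.
Proof.
move=> ij; rewrite -subset0 => -[[u|u]|x] [] //=; rewrite !prefix_rconsE;
  move=> /and3P[_ _ /eqP ui] /and3P[_ _ /eqP uj]; move: ij;
  by rewrite -ui -uj eqxx.
Qed.

Lemma below_rcons_self v i :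
  ~ below (rcons v i) (inl (inl v)) /\ ~ below (rcons v i) (inl (inr v)).
Proof. by rewrite /below /= !prefix_rconsE ltnn andbF. Qed.

(** * Dependence structure of the car counts in one model *)

Section one_model.
Local Open Scope ereal_scope.
Context d (T : measurableType d) (R : realType) (P : probability T R).
Variables (offspring law : probability nat R).
Variables (Z eta : vertex -> {RV P >-> nat}) (tie : vertex -> nat -> {RV P >-> nat}).
Hypothesis model : parking_model offspring law Z eta tie.

Definition cars t (v : vertex) (w : T) :=
  cars_before (fun v => Z v w) (fun v => eta v w) t v.

Definition cars_from_children t (v : vertex) n (w : T) :=
  (\sum_(i < n) (cars t (rcons v i) w).-1)%N.

Notation depends := (depends_on (drivers Z eta tie)).

Lemma carsS t v : cars t.+1 v =
  fun w => (eta v w + cars_from_children t v (Z v w) w)%N.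
Proof. by []. Qed.

Lemma depends_on_Z v : depends [set inl (inl v)] (Z v).
Proof. exact: (depends_on_driver (X := drivers Z eta tie) (i := inl (inl v))). Qed.

Lemma depends_on_eta v : depends [set inl (inr v)] (eta v).
Proof. exact: (depends_on_driver (X := drivers Z eta tie) (i := inl (inr v))). Qed.

(** Cars only move towards the root. In the induction on [t], the random number of children is fixed
    to [n] by [depends_on_mix]. *)
Lemma depends_on_cars t v : depends (below v) (cars t v).
Proof.
elim: t v => [|t IH] v; first exact: depends_on_cst.
rewrite carsS.
apply: (depends_on_mix (g := fun n w => (eta v w + cars_from_children t v n w)%N)).
  by apply: (depends_on_subset _ (@depends_on_Z v)) => _ -> /=; exact: prefix_refl.
move=> n; apply: depends_on_add.
  by apply: (depends_on_subset _ (@depends_on_eta v)) => _ -> /=; exact: prefix_refl.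
apply: (depends_on_sum (f := fun i w => (cars t (rcons v i) w).-1)) => i _.
apply: (depends_on_comp predn).
by apply: (depends_on_subset _ (IH (rcons v i))); exact: below_rcons.
Qed.

Lemma depends_on_cars_from_children t v n :
  depends (below_children v n) (cars_from_children t v n).
Proof.
apply: (depends_on_sum (f := fun i w => (cars t (rcons v i) w).-1)) => i iltn.
apply: (depends_on_comp predn).
by apply: (depends_on_subset _ (@depends_on_cars t (rcons v i))) => x ?; exists i.
Qed.

Lemma disjoint_independent G H f g : G `&` H = set0 ->
  depends G f -> depends H g -> independent_nat P f g.
Proof.
move=> GH fG gH A B; apply: (depends_on_independent _ _ _ GH fG gH).
exact: model_independent model.
Qed.

Lemma nat_measurable_depends G f : depends G f -> nat_measurable f.
Proof. by move=> fG A; exact: depends_on_measurable fG. Qed.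

Lemma nat_measurable_cars t v : nat_measurable (cars t v).
Proof. exact: nat_measurable_depends (@depends_on_cars t v). Qed.

Lemma independent_children t v n :
  independent_nat P (cars_from_children t v n) (predn \o cars t (rcons v n)).
Proof.
apply: (@disjoint_independent (below_children v n) (below (rcons v n))).
- rewrite -subset0 => x [[j jn xj] xn].
  by rewrite -(@below_rcons_disjoint v j n) // ltn_eqF.
- exact: depends_on_cars_from_children.
- by apply: depends_on_comp; exact: depends_on_cars.
Qed.

Lemma independent_eta t v n : independent_nat P (eta v) (cars_from_children t v n).
Proof.
apply: (@disjoint_independent [set inl (inr v)] (below_children v n)).
- by rewrite -subset0 => _ [-> [j _ /(below_rcons_self v j).2]].
- exact: depends_on_eta.
- exact: depends_on_cars_from_children.
Qed.

(** The sum has fixed length [n], so it does not read the driver [Z v]; this is the form in which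
    [mix_stochastic_le] restores the random length. *)
Lemma independent_Z_children t v n :
  independent_nat P (Z v) (fun w => eta v w + cars_from_children t v n w)%N.
Proof.
apply: (@disjoint_independent [set inl (inl v)]
  ([set inl (inr v)] `|` below_children v n)).
- by rewrite -subset0 => _ [-> [//|[j _ /(below_rcons_self v j).1]]].
- exact: depends_on_Z.
- apply: depends_on_add.
    by apply: (depends_on_subset _ (@depends_on_eta v)) => x ?; left.
  apply: (depends_on_subset _ (@depends_on_cars_from_children t v n)) => x ?.
  by right.
Qed.

Lemma independent_Z_child t v i :
  independent_nat P (Z v) (predn \o cars t (rcons v i)).
Proof.
apply: (@disjoint_independent [set inl (inl v)] (below (rcons v i))).
- by rewrite -subset0 => _ [-> /(below_rcons_self v i).1].
- exact: depends_on_Z.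
- by apply: depends_on_comp; exact: depends_on_cars.
Qed.

End one_model.

(** * Monotonicity of the car counts in the arrival law *)

Section two_models.
Local Open Scope ereal_scope.
Context d (T : measurableType d) (R : realType) (P : probability T R).
Variables (offspring law law' : probability nat R).
Variables (Z eta eta' : vertex -> {RV P >-> nat}).
Variables (tie : vertex -> nat -> {RV P >-> nat}).
Hypothesis model : parking_model offspring law Z eta tie.
Hypothesis model' : parking_model offspring law' Z eta' tie.
Hypothesis law_le : forall k : nat,
  law [set n | (k <= n)%N] <= law' [set n | (k <= n)%N].

Lemma stochastic_le_predn (f g : T -> nat) :
  stochastic_le P f g -> stochastic_le P (predn \o f) (predn \o g).
Proof.
move=> fg k; have pE (h : T -> nat) :
    [set w | (k < (predn \o h) w)%N] = [set w | (k.+1 < h w)%N].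
  by apply/seteqP; split=> w /=; lia.
by rewrite !pE.
Qed.

(** Induction on [t]: the children are added one by one, then the initial cars, and finally the
    number of children is mixed over. Allowing two vertices also yields, for a single model, that
    the law of the count is the same at all vertices. *)
Lemma stochastic_le_cars t u v : stochastic_le P (cars Z eta t u) (cars Z eta' t v).
Proof.
elim: t u v => [|t IH] u v; first by [].
have mc e x n :=
  nat_measurable_depends (@depends_on_cars_from_children _ _ _ _ Z e tie t x n).
have le_children n : stochastic_le P
    (cars_from_children Z eta t u n) (cars_from_children Z eta' t v n).
  elim: n => [|n IHn].
    have children0 e x : cars_from_children Z e t x 0 = fun=> 0%N.
      by apply/funext => w; rewrite /cars_from_children big_ord0.
    by rewrite !children0.
  have childrenS e x : cars_from_children Z e t x n.+1 = fun w =>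
      (cars_from_children Z e t x n w + (predn \o cars Z e t (rcons x n)) w)%N.
    by apply/funext => w; rewrite /cars_from_children big_ord_recr.
  rewrite !childrenS; apply: stochastic_le_add => //.
  - move=> A.
    exact: (@nat_measurable_cars _ _ _ _ Z eta tie t _ (predn @^-1` A)).
  - move=> A.
    exact: (@nat_measurable_cars _ _ _ _ Z eta' tie t _ (predn @^-1` A)).
  - exact: (independent_children model).
  - exact: (independent_children model').
  - by apply: stochastic_le_predn; exact: IH.
rewrite !carsS.
have mZ x : nat_measurable (Z x) :=
  nat_measurable_depends (@depends_on_Z _ _ _ _ Z eta tie x).
have me (e : vertex -> {RV P >-> nat}) x : nat_measurable (e x) :=
  nat_measurable_depends (@depends_on_eta _ _ _ _ Z e tie x).
have ms (e : vertex -> {RV P >-> nat}) x n :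
    nat_measurable (fun w => e x w + cars_from_children Z e t x n w)%N.
  by apply: (nat_measurable_mix
    (g := fun m w => (m + cars_from_children Z e t x n w)%N)) => // m;
    exact: nat_measurable_addn.
apply: (mix_stochastic_le
  (g := fun n w => (eta u w + cars_from_children Z eta t u n w)%N)
  (g' := fun n w => (eta' v w + cars_from_children Z eta' t v n w)%N)) => //.
- by move=> n; exact: (independent_Z_children model).
- by move=> n; exact: (independent_Z_children model').
- by move=> n; have := offspring_law model u [set n];
    rewrite -(offspring_law model' v [set n]).
- move=> n; apply: stochastic_le_add => //.
  + exact: (independent_eta model).
  + exact: (independent_eta model').
  (* The strict tail at [k] is the weak tail at [k.+1]. *)
  + move=> k; have := law_le k.+1.
    by rewrite -(arrival_law model u) -(arrival_law model' v).
Qed.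

End two_models.

(** * The recursion for the means and its limit *)

Fixpoint mean_rec (R : realType) (lambda a : R) (p : nat -> R) (t : nat) : R :=
  if t is t'.+1 then a + lambda * (mean_rec lambda a p t' - 1 + p t') else 0.

Section root_mean.
Local Open Scope ereal_scope.
Context d (T : measurableType d) (R : realType) (P : probability T R).
Variables (lambda a : R) (offspring law : probability nat R).
Variables (Z eta : vertex -> {RV P >-> nat}) (tie : vertex -> nat -> {RV P >-> nat}).
Hypothesis model : parking_model offspring law Z eta tie.
Hypothesis offspring_mean : 'E_offspring[fun k : nat => k%:R] = lambda%:E.
Hypothesis law_mean : 'E_law[fun k : nat => k%:R] = a%:E.

Lemma mean_distribution (f : {RV P >-> nat}) (nu : probability nat R) :
  (forall A, distribution P f A = nu A) ->
  \int[P]_w (f w)%:R%:E = 'E_nu[fun k : nat => k%:R].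
Proof.
move=> fnu; rewrite unlock (mean_tails nu (f := id)); last by [].
rewrite mean_tails; last by move=> A; exact: measurable_preimage_nat.
by apply: eq_eseriesr => k _; exact: (fnu [set n | (k < n)%N]).
Qed.

Definition prob_no_cars t : R := fine (P [set w | cars Z eta t [::] w = 0%N]).

Definition mean_cars := mean_rec lambda a prob_no_cars.

Let mcars t v := @nat_measurable_cars _ _ _ P Z eta tie t v.

Lemma tail_cars t v k :
  P [set w | (k < cars Z eta t v w)%N] = P [set w | (k < cars Z eta t [::] w)%N].
Proof. by apply/le_anti/andP; split; exact: (stochastic_le_cars model model). Qed.

Lemma prob_cars t v :
  P [set w | (0 < cars Z eta t v w)%N] = (1 - prob_no_cars t)%:E.
Proof.
have m0 : measurable [set w | cars Z eta t [::] w = 0%N] := mcars t [::] [set 0%N].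
rewrite tail_cars.
have -> : [set w | (0 < cars Z eta t [::] w)%N] =
    ~` [set w | cars Z eta t [::] w = 0%N].
  by apply/seteqP; split=> w /=; rewrite lt0n => /eqP.
by rewrite probability_setC // /prob_no_cars EFinB fineK // fin_num_measure.
Qed.

Lemma mean_carsE t v : \int[P]_w (cars Z eta t v w)%:R%:E = (mean_cars t)%:E.
Proof.
elim: t v => [|t IH] v; first by rewrite integral0_eq.
have mpred u : nat_measurable (predn \o cars Z eta t u).
  by move=> A; exact: (mcars t u (predn @^-1` A)).
(* This comes from taking means in N = (N - 1)^+ + 1_{N > 0}, where the indicator has mean 1 -
   p_t. *)
have mean_pred u : \int[P]_w ((predn \o cars Z eta t u) w)%:R%:E =
    (mean_cars t - 1 + prob_no_cars t)%:E.
  have mpos : nat_measurable (fun w => (0 < cars Z eta t u w)%N : nat).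
    by move=> A; exact: (mcars t u ((fun n => (0 < n)%N : nat) @^-1` A)).
  have mean_pos : \int[P]_w (0 < cars Z eta t u w)%N%:R%:E = (1 - prob_no_cars t)%:E.
    rewrite mean_tails // -(prob_cars t u) (nneseries_split 0 1) //.
    rewrite big_nat1 eseries0 ?adde0 => [|k k0 _].
      by congr (P _); apply/seteqP; split=> w /=; rewrite lt0b.
    rewrite -(@measure0 _ _ _ P); congr (P _).
    by apply/seteqP; split=> w //=; case: (0 < cars _ _ _ _ _)%N; lia.
  have /esym := IH u; have carsE w : cars Z eta t u w =
      ((predn \o cars Z eta t u) w + (0 < cars Z eta t u w)%N)%N.
    by rewrite /=; case: (cars _ _ _ _ _) => //= n; rewrite addn1.
  under eq_integral do rewrite carsE.
  rewrite mean_add // mean_pos => meanE.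
  (* An infinite mean cannot add up with a real one to the real [mean_cars t], so only the finite
     case survives. *)
  move: meanE; case: (\int[P]_w _) => [r [->]||] //.
  by congr EFin; ring.
have mZ : nat_measurable (Z v) :=
  nat_measurable_depends (@depends_on_Z _ _ _ P Z eta tie v).
rewrite carsS mean_add; first last.
- apply: (nat_measurable_mix (g := cars_from_children Z eta t v)) => // n.
  exact: nat_measurable_depends
    (@depends_on_cars_from_children _ _ _ P Z eta tie t v n).
- exact: nat_measurable_depends (@depends_on_eta _ _ _ P Z eta tie v).
rewrite (mean_distribution (arrival_law model v)) law_mean.
rewrite (mean_random_sum (Y := fun i => predn \o cars Z eta t (rcons v i))
  mZ _ _ _ (fun i => mean_pred (rcons v i))) //.
- by rewrite (mean_distribution (offspring_law model v)) offspring_mean muleC.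
- move=> i k; exact: (independent_Z_child model t v i [set n | (i < n)%N]
    [set n | (k < n)%N]).
- by move=> i; rewrite fin_num_measure //; exact: (mZ [set n | (i < n)%N]).
Qed.

Lemma le_cars s t w : (s <= t)%N -> (cars Z eta s [::] w <= cars Z eta t [::] w)%N.
Proof.
move=> st; have := @homo_leq _ (fun t => cars Z eta t [::] w) leq leqnn leq_trans.
by apply => //; move=> n; exact: leq_cars_before.
Qed.

Lemma cvg_root_arrivals w :
  (cars Z eta t [::] w)%:R%:E @[t --> \oo] --> root_arrivals Z eta tie w.
Proof.
rewrite /root_arrivals root_visitsE; last first.
  by move=> v m; exact: tie_range model v m w.
apply: ereal_nondecreasing_is_cvgn => s t st.
by rewrite lee_fin ler_nat; exact: le_cars.
Qed.

(** The counts increase to their limit, which vanishes only if they all do. Continuity of [P] along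
    this decreasing intersection then gives the limit of [prob_no_cars]. *)
Lemma root_arrivals_eq0 :
  [set w | root_arrivals Z eta tie w = 0] =
  \bigcap_t [set w | cars Z eta t [::] w = 0%N].
Proof.
apply/seteqP; split => w /= => [X0 t _ /=|c0].
  have : (cars Z eta t [::] w)%:R%:E <= root_arrivals Z eta tie w.
    rewrite -(cvg_lim _ (@cvg_root_arrivals w)) //.
    rewrite (cvg_lim _ (ereal_nondecreasing_cvgn _)) // => [|n m nm].
      by apply: ereal_sup_ubound; exists t.
    by rewrite lee_fin ler_nat; exact: le_cars.
  by rewrite X0 lee_fin lern0 => /eqP.
rewrite -(cvg_lim _ (@cvg_root_arrivals w)) //.
by under eq_fun do rewrite c0 //; rewrite lim_cst.
Qed.

(** Monotone convergence, with the limit allowed to be infinite: at the threshold it serves to prove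
    finiteness. *)
Lemma cvg_mean_cars :
  (mean_cars t)%:E @[t --> \oo] --> \int[P]_w root_arrivals Z eta tie w.
Proof.
have -> : \int[P]_w root_arrivals Z eta tie w =
    \int[P]_w limn (fun t => (cars Z eta t [::] w)%:R%:E).
  by apply: eq_integral => w _; rewrite (cvg_lim _ (@cvg_root_arrivals w)).
under eq_fun do rewrite -(mean_carsE _ [::]).
apply: cvg_monotone_convergence => //.
- by move=> n; exact: (nat_measurable_fun (fun k => k%:R%:E) (mcars n [::])).
- by move=> w _ n m nm; rewrite lee_fin ler_nat; exact: le_cars.
Qed.

Lemma mean_cars_le t :
  (mean_cars t)%:E <= \int[P]_w root_arrivals Z eta tie w.
Proof.
rewrite -(cvg_lim _ cvg_mean_cars) //.
apply: lime_ge; first exact: cvgP cvg_mean_cars.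
exists t => // n /= tn; rewrite -!(mean_carsE _ [::]).
apply: ge0_le_integral => //.
- exact: (nat_measurable_fun (fun k => k%:R%:E) (mcars t [::])).
- exact: (nat_measurable_fun (fun k => k%:R%:E) (mcars n [::])).
- by move=> w _; rewrite lee_fin ler_nat; exact: le_cars.
Qed.

Lemma cvg_prob_no_cars : prob_no_cars t @[t --> \oo] -->
  fine (P [set w | root_arrivals Z eta tie w = 0]).
Proof.
have m0 t : measurable [set w | cars Z eta t [::] w = 0%N] := mcars t [::] [set 0%N].
apply: fine_cvg; rewrite root_arrivals_eq0 fineK; last first.
  by rewrite fin_num_measure //; exact: bigcapT_measurable.
apply: nonincreasing_cvg_mu => //.
- by rewrite ltey_eq fin_num_measure.
- exact: bigcapT_measurable.
- move=> n m nm; apply/subsetPset => w /=.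
  by have := le_cars w nm; lia.
Qed.

Lemma mean_root_arrivals_finite : (1 < lambda)%R ->
  \int[P]_w root_arrivals Z eta tie w < +oo ->
  \int[P]_w root_arrivals Z eta tie w =
  ((lambda - a - lambda * fine (P [set w | root_arrivals Z eta tie w = 0])) /
    (lambda - 1))%:E.
Proof.
move=> lambda1 EX; set p := fine _.
have EX0 : 0 <= \int[P]_w root_arrivals Z eta tie w.
  apply: integral_ge0 => w _; apply: nneseries_ge0 => t _ _.
  by rewrite lee_fin.
have := cvg_mean_cars.
rewrite -(fineK (x := \int[P]_w _)) ?ge0_fin_numE //.
set x := fine _ => /fine_cvg /= cvgx.
congr EFin.
(* The recursion passes to the limit because [x] is real; the resulting equation is linear in [x],
   and [lambda - 1] is nonzero. *)
have xE : x = (a + lambda * (x - 1 + p))%R.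
  have cvgxS : mean_cars t.+1 @[t --> \oo] --> x.
    by have := cvgx; rewrite -(cvg_shiftS mean_cars).
  apply: (cvg_unique _ cvgxS) => //.
  apply: cvgD; first exact: cvg_cst.
  apply: cvgM; first exact: cvg_cst.
  apply: cvgD; last exact: cvg_prob_no_cars.
  by apply: cvgB => //; exact: cvg_cst.
have l0 : (lambda - 1 != 0)%R by lra.
apply: (mulIf l0); rewrite divfK //.
lra.
Qed.

End root_mean.

(** As [q s <= p s], the gap D_t between the two recursions satisfies D_{t+1} <= (b - a) + lambda
    D_t; iterating gives the geometric sum. *)
Lemma mean_rec_le (R : realType) (lambda a b : R) (p q : nat -> R) t :
  0 <= lambda -> a <= b -> (forall s, q s <= p s) ->
  mean_rec lambda b q t <=
  mean_rec lambda a p t + (b - a) * \sum_(s < t) lambda ^+ s.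
Proof.
move=> lambda0 ab qp; elim: t => [|t IH] /=; first by rewrite big_ord0 mulr0 addr0.
rewrite big_ord_recl expr0; under eq_bigr do rewrite /= exprS.
rewrite -mulr_sumr; set S := \sum_(_ < t) _ in IH *.
have := ler_wpM2l lambda0 (lerD IH (qp t)); lra.
Qed.

(** * Uniform bounds on the means, below and at the threshold *)

Section threshold.
Local Open Scope ereal_scope.
Context d (T : measurableType d) (R : realType) (P : probability T R).
Variables (lambda : R) (offspring : probability nat R).
Variables (I : set R) (law : R -> probability nat R).
Variables (Z : vertex -> {RV P >-> nat}) (eta : R -> vertex -> {RV P >-> nat}).
Variables (tie : vertex -> nat -> {RV P >-> nat}) (alpha_c : R).
Hypothesis lambda_gt1 : (1 < lambda)%R.
Hypothesis offspring_mean : 'E_offspring[fun k : nat => k%:R] = lambda%:E.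
Hypothesis law_family : arrival_family I law.
Hypothesis model : forall a, I a -> parking_model offspring (law a) Z (eta a) tie.
Hypothesis threshold : critical_threshold I Z eta tie alpha_c.

(** The tail at 0 equals 1 - p_s, so the stochastic order is reversed. *)
Lemma prob_no_cars_le a b s : I a -> I b -> (a <= b)%R ->
  (prob_no_cars Z (eta b) s <= prob_no_cars Z (eta a) s)%R.
Proof.
move=> Ia Ib ab.
have := stochastic_le_cars (model Ia) (model Ib)
  (fun k => stochastically_increasing law_family Ia Ib ab k) s [::] [::] 0%N.
by rewrite (prob_cars (model Ia)) (prob_cars (model Ib)) lee_fin lerD2l lerN2.
Qed.

(** The limit formula holds below the threshold; dropping its two nonpositive terms in the numerator
    gives a bound free of [a] and [t]. *)
Lemma mean_subcritical_le a t : I a -> (a < alpha_c)%R ->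
  (mean_cars lambda a Z (eta a) t <= lambda / (lambda - 1))%R.
Proof.
move=> Ia ac; have [_ sub _] := threshold.
have := mean_cars_le (model Ia) offspring_mean (arrival_mean law_family Ia) t.
rewrite (mean_root_arrivals_finite (model Ia) offspring_mean
  (arrival_mean law_family Ia) lambda_gt1 (sub _ Ia ac)) lee_fin.
move=> /le_trans; apply; rewrite ler_pM2r ?invr_gt0; last by rewrite subr_gt0.
have a0 : (0 <= a)%R by exact: index_ge0 law_family _ Ia.
have : (0 <= lambda * fine (P [set w | root_arrivals Z (eta a) tie w = 0]))%R.
  by rewrite mulr_ge0 ?fine_ge0 // (le_trans ler01) // ltW.
lra.
Qed.

Lemma mean_critical_le t :
  (mean_cars lambda alpha_c Z (eta alpha_c) t <= lambda / (lambda - 1))%R.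
Proof.
have [/andP[ac0 ac1] _ _] := threshold.
have Iu (a : R) : (0 < a < 1)%R -> I a.
  by move=> a01; apply: index_unit law_family _ _; rewrite /= in_itv.
have lambda0 : (0 <= lambda)%R by rewrite (le_trans ler01) // ltW.
set K := (\sum_(s < t) lambda ^+ s)%R.
have K0 : (0 <= K)%R by apply: sumr_ge0 => s _; exact: exprn_ge0.
apply/ler_addgt0Pr => e e0.
(* The first bound keeps [alpha_c - h] inside the unit interval, hence in [I]; the second makes the
   error [h * K] at most [e]. The denominator is [K + 1] since [K] is 0 when [t] is 0. *)
pose h : R := Num.min (alpha_c / 2)%R (e / (K + 1))%R.
have h0 : (0 < h)%R by rewrite lt_min !divr_gt0 //; lra.
have hc : (h <= alpha_c / 2)%R by rewrite ge_min lexx.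
have hK : (h * K <= e)%R.
  have : (h <= e / (K + 1))%R by rewrite ge_min lexx orbT.
  rewrite ler_pdivlMr; last lra.
  nra.
have Ia : I (alpha_c - h)%R by apply: Iu; lra.
have Ic : I alpha_c by apply: Iu; lra.
have ac : (alpha_c - h <= alpha_c)%R by lra.
have hlt : (alpha_c - h < alpha_c)%R by lra.
have := mean_rec_le t lambda0 ac (fun s => prob_no_cars_le s Ia Ic ac).
by have := mean_subcritical_le t Ia hlt; rewrite /mean_cars -/K; lra.
Qed.

End threshold.

Theorem theorem1 (d : measure_display) (T : measurableType d) (R : realType)
    (P : probability T R)
    (lambda : R) (offspring : probability nat R)
    (I : set R) (law : R -> probability nat R)
    (Z : vertex -> {RV P >-> nat}) (eta : R -> vertex -> {RV P >-> nat})
    (tie : vertex -> nat -> {RV P >-> nat}) (alpha_c : R)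
    (lambda_gt1 : 1 < lambda)
    (offspring_mean : ('E_offspring[ (fun k : nat => k%:R) ] = lambda%:E)%E)
    (law_family : arrival_family I law)
    (model : forall a, I a -> parking_model offspring (law a) Z (eta a) tie)
    (threshold : critical_threshold I Z eta tie alpha_c)
    (alpha : R) (alphaI : I alpha) (alpha_le : alpha <= alpha_c) :
  let X := root_arrivals Z (eta alpha) tie in
  (\int[P]_w X w)%E =
  ((lambda - alpha - lambda * fine (P [set w | X w = 0%E])) / (lambda - 1))%:E.
Proof.
move=> X; apply: (mean_root_arrivals_finite (model _ alphaI) offspring_mean
  (arrival_mean law_family alphaI) lambda_gt1).
have [_ sub _] := threshold.
move: alpha_le; rewrite le_eqVlt => /predU1P[ac|]; last exact: sub.
(* At the threshold only finiteness of the mean remains: it is the limit of means bounded uniformly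
   in [t]. *)
have cvgX := cvg_mean_cars (model _ alphaI) offspring_mean
  (arrival_mean law_family alphaI).
rewrite -(cvg_lim _ cvgX) //.
apply: le_lt_trans (ltry (lambda / (lambda - 1))).
apply: lime_le; first exact: cvgP cvgX.
apply: nearW => t; rewrite lee_fin ac.
exact: (mean_critical_le lambda_gt1 offspring_mean law_family model threshold).
Qed.
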